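(* Let $f:[a,b]\to[c,d]$ and $G:[c,d]\to\mathbb{R}$. Suppose that $f$ is Riemann integrable on $[a,b]$, that $G$ is bounded on $[c,d]$, and that $\lambda(f^{-1}(D(G)))=0$, where $D(G)=\{y\in[c,d]: G \text{ is discontinuous at } y\}$. Then the composition $h=G\circ f:[a,b]\to\mathbb{R}$ is Riemann integrable on $[a,b]$.
   Context: Here $a<b$ and $c<d$ are real numbers, $\lambda$ is Lebesgue measure on $\mathbb{R}$, and $f^{-1}(A)$ denotes the preimage of a set $A$ under $f$. Continuity of $G$ at a point is understood relative to its domain $[c,d]$. *)

(* Defs.v *)
From Stdlib Require Import Reals.
From mathcomp Require Import all_boot all_order all_algebra.
From mathcomp Require Import classical_sets reals ereal measure lebesgue_measure.
From mathcomp Require Import Rstruct Rstruct_topology.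
From Coquelicot Require Import Coquelicot.

Open Scope classical_set_scope.
(* Opened last, so that [<], [<=] on [R] are [Rlt], [Rle]. *)
Open Scope R_scope.

(* Functions with domain a compact interval are modelled by total functions
   on [R], of which only the values on the interval matter. *)

Definition cc (a b : R) : set R := [set x : R | a <= x <= b].

(* [continue_in G E y] is continuity of [G] at [y] relative to [E]: at the
   endpoints of the interval it is one-sided. *)
Definition discontinuities (c d : R) (G : R -> R) : set R :=
  [set y : R | cc c d y /\ ~ continue_in G (cc c d) y].

(* The preimage of [B] under [f], seen as a function with domain [[a, b]]. *)
Definition preimage_cc (a b : R) (f : R -> R) (B : set R) : set R :=
  cc a b `&` f @^-1` B.

Definition bounded_on (E : set R) (g : R -> R) : Prop :=
  exists M : R, forall y : R, E y -> Rabs (g y) <= M.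

(* Main.v *)
Require Import Defs.
From Stdlib Require Import Reals Lra.
From mathcomp Require Import all_boot all_order all_algebra.
From mathcomp Require Import classical_sets reals ereal measure lebesgue_measure.
From mathcomp Require Import Rstruct Rstruct_topology.
From mathcomp Require Import boolp set_interval sequences.
From mathcomp Require Import lebesgue_stieltjes_measure.
From Coquelicot Require Import Coquelicot.
Import Order.TTheory GRing.Theory Num.Theory.

Open Scope classical_set_scope.
Open Scope R_scope.

(** The function [h = G o f] is bounded, and it is continuous at every point
    of [[a, b]] except those where [f] is discontinuous or which [f] maps to a
    discontinuity of [G] ([discontinuities_comp]).  Both exceptional sets are
    negligible, so the result is Lebesgue's criterion for Riemann
    integrability, used in both directions.

    Negligibility is phrased without measures: a set is [thin] if it has
    countable covers by open intervals of arbitrarily small total length.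
    Thinness of the second set is the hypothesis on the completed Lebesgue
    measure, which is an infimum over covers by half-open intervals; enlarging
    these slightly makes them open ([thin_of_null]).

    If [f] is integrable, it is within [psi] of a step function [phi], where
    [psi] is a step function of small integral.  The steps on which [psi] is
    large are short in total; off them, and off the division points, [phi] is
    locally constant and [psi] is small, so [f] oscillates little
    ([RInt_oscillation_cover]).  Doing this for the oscillations [1/(k+1)],
    with a geometrically decreasing budget of length, shows that the
    discontinuities are thin ([thin_discontinuities]).

    Conversely, let [h] be bounded by [M] with thin discontinuities.  Around
    each point [h] oscillates little or an interval of the cover contains a
    neighbourhood; by compactness one radius [d] serves for all points
    ([uniform_dichotomy]).  On pieces shorter than [d], replace [h] by its value
    at an endpoint: the error is small on good pieces and at most [2 M] on
    pieces inside the cover, hence it is dominated by a constant plus [2 M]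
    times the number of cover intervals containing the point.  The integral of
    that number is at most the total length of the intervals, so [h] is within a
    function of small integral of an integrable function, which forces
    integrability ([ex_RInt_of_close_integrable]). *)

(** * Integrability by approximation *)

Lemma is_RInt_Riemann_sum (f : R -> R) (a b l e : R) :
  a < b -> is_RInt f a b l -> 0 < e ->
  Riemann_fine a b (fun ptd => Rabs (Riemann_sum f ptd - l) < e).
Proof.
move=> ab fl e0; have := fl _ (locally_ball l (mkposreal e e0)).
rewrite /filtermap; apply: (filter_imp (F := Riemann_fine a b)) => ptd.
by rewrite (sign_eq_1 (b - a)) ?scal_one //; lra.
Qed.

(** The Riemann sums of [h] differ from those of [phi] by at most those of
    [psi], so they form a Cauchy family as soon as the integral of [psi] can be
    made arbitrarily small. *)
Lemma ex_RInt_of_close_integrable (h : R -> R) (a b : R) :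
  a < b ->
  (forall e, 0 < e -> exists (phi psi : R -> R) (I : R),
     ex_RInt phi a b /\
     is_RInt psi a b I /\ I <= e /\
     forall t, a <= t <= b -> Rabs (h t - phi t) <= psi t) ->
  ex_RInt h a b.
Proof.
move=> ab close.
have sg : sign (b - a) = 1 by apply: sign_eq_1; lra.
apply/(filterlim_locally_cauchy (U := R_CompleteNormedModule)) => -[e e0].
have e6 : 0 < e / 6 by lra.
have [phi [psi [I [[J phiJ] [psiI [Ie hpsi]]]]]] := close _ e6.
pose near (s : SF_seq) := (pointed_subdiv s /\
   SF_h s = Rmin a b /\ seq.last (SF_h s) (SF_lx s) = Rmax a b) /\
   Rabs (Riemann_sum phi s - J) < e / 6 /\ Rabs (Riemann_sum psi s - I) < e / 6.
exists near; split.
  apply: filter_and; last first.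
    by apply: filter_and; apply: is_RInt_Riemann_sum.
  by rewrite /Riemann_fine /within; apply: filter_forall.
have hsum s : near s -> Rabs (Riemann_sum h s - J) < e / 2.
  move=> [[ps [sa sb]] [sphi spsi]].
  have := Riemann_sum_norm (fun t => minus (h t) (phi t)) psi s ps.
  rewrite Riemann_sum_minus sb sa Rmin_left; last lra.
  rewrite Rmax_right; last lra.
  move=> /(_ hpsi).
  rewrite /norm /minus /plus /opp /= /abs /=.
  move=> {close hpsi phiJ psiI} hs; move: sphi spsi hs.
  set x := Riemann_sum h s; set y := Riemann_sum phi s; set z := Riemann_sum psi s.
  by split_Rabs; lra.
move=> u v /hsum hu /hsum hv; rewrite sg !scal_one.
rewrite /ball /= /AbsRing_ball /minus /plus /opp /abs /=.
move: hu hv; set x := Riemann_sum h u; set y := Riemann_sum h v.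
by move=> {close hpsi hsum}; split_Rabs; lra.
Qed.

(** * Lists of open intervals and thin sets *)

(* The innermost comparison goes first: destructing an outer one would move
   the undecided inner ones into a hypothesis. *)
Ltac split_Rdec := repeat match goal with
  | |- context [Rle_dec ?x ?y] =>
      lazymatch constr:((x, y)) with
      | context [Rle_dec _ _] => fail
      | _ => destruct (Rle_dec x y)
      end
  | |- context [Rlt_dec ?x ?y] => destruct (Rlt_dec x y)
  end; simpl.

Fixpoint covered (L : seq (R * R)) (t : R) : Prop :=
  if L is J :: L' then J.1 < t < J.2 \/ covered L' t else False.

Definition total_length (L : seq (R * R)) : R :=
  foldr (fun J s => Rmax 0 (J.2 - J.1) + s) 0 L.

Definition oo_indicator (J : R * R) (t : R) : R :=
  if Rlt_dec J.1 t then if Rlt_dec t J.2 then 1 else 0 else 0.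

(** The sum of the indicators, rather than the indicator of the union: it
    adds up under concatenation and its integral needs no disjointness. *)
Definition multiplicity (L : seq (R * R)) (t : R) : R :=
  foldr (fun J s => oo_indicator J t + s) 0 L.

Lemma covered_cat L1 L2 t : covered (L1 ++ L2) t <-> covered L1 t \/ covered L2 t.
Proof. by elim: L1 => [|J L1 IH] /=; tauto. Qed.

Lemma total_length_cat L1 L2 :
  total_length (L1 ++ L2) = total_length L1 + total_length L2.
Proof. by elim: L1 => [|J L1 IH] /=; [lra | rewrite IH; lra]. Qed.

Lemma multiplicity_cat L1 L2 t :
  multiplicity (L1 ++ L2) t = multiplicity L1 t + multiplicity L2 t.
Proof. by elim: L1 => [|J L1 IH] /=; [lra | rewrite IH; lra]. Qed.

Lemma oo_indicator_ge0 J t : 0 <= oo_indicator J t.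
Proof. by rewrite /oo_indicator; split_Rdec; lra. Qed.

Lemma multiplicity_ge0 L t : 0 <= multiplicity L t.
Proof.
elim: L => [|J L IH] /=; first lra.
by have := oo_indicator_ge0 J t; lra.
Qed.

Lemma covered_multiplicity L t : covered L t -> 1 <= multiplicity L t.
Proof.
elim: L => //= J L IH [Jt|/IH Lt].
  have := multiplicity_ge0 L t; rewrite /oo_indicator.
  by split_Rdec; move=> *; lra.
by have := oo_indicator_ge0 J t; lra.
Qed.

(** The values at the endpoints are left free, so that the pieces of a step
    function can be integrated separately. *)
Lemma is_RInt_piece (f : R -> R) (a b v : R) :
  a <= b -> (forall x, a < x < b -> f x = v) -> is_RInt f a b ((b - a) * v).
Proof.
move=> ab fv; apply: (is_RInt_ext (fun=> v)); last exact: is_RInt_const.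
by move=> x; rewrite Rmin_left // Rmax_right // => /fv.
Qed.

Lemma is_RInt_oo_indicator (J : R * R) (a b : R) : a <= b ->
  exists l, is_RInt (oo_indicator J) a b l /\ l <= Rmax 0 (J.2 - J.1).
Proof.
case: J => u v ab /=.
(* The ends of the interval, clipped to [[a, b]]. *)
pose p := Rmax a (Rmin u b); pose q := Rmax p (Rmin v b).
have [ap [pq qb]] : a <= p /\ p <= q /\ q <= b.
  by rewrite /q /p /Rmax /Rmin; split_Rdec; lra.
have z x : a < x < p -> oo_indicator (u, v) x = 0.
  rewrite /oo_indicator /p /Rmax /Rmin /=.
  by split_Rdec; move=> *; lra.
have o x : p < x < q -> oo_indicator (u, v) x = 1.
  rewrite /oo_indicator /q /p /Rmax /Rmin /=.
  by split_Rdec; move=> *; lra.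
have y x : q < x < b -> oo_indicator (u, v) x = 0.
  rewrite /oo_indicator /q /p /Rmax /Rmin /=.
  by split_Rdec; move=> *; lra.
exists (((p - a) * 0 + (q - p) * 1) + (b - q) * 0); split.
  apply: (is_RInt_Chasles _ _ q); last exact: is_RInt_piece.
  by apply: (is_RInt_Chasles _ _ p); exact: is_RInt_piece.
move: ap pq qb {z o y}; rewrite /q /p /Rmax /Rmin.
by split_Rdec; move=> *; lra.
Qed.

Lemma is_RInt_multiplicity (L : seq (R * R)) (a b : R) : a <= b ->
  exists l, is_RInt (multiplicity L) a b l /\ l <= total_length L.
Proof.
move=> ab; elim: L => [|J L [l [Ll lL]]] /=.
  by exists ((b - a) * 0); split; [exact: is_RInt_const | lra].
have [m [Jm mJ]] := is_RInt_oo_indicator J a b ab.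
by exists (m + l); split; [exact: is_RInt_plus | lra].
Qed.

(** Countable covers are families of finite lists rather than sequences of
    intervals: uniting two covers is then concatenation in each rank, and a
    finite batch of intervals can be spent on each of countably many tasks. *)
Fixpoint first_lists (U : nat -> seq (R * R)) (K : nat) : seq (R * R) :=
  if K is K'.+1 then U K' ++ first_lists U K' else [::].

Lemma multiplicity_first_lists_mono U K K' t : (K <= K')%N ->
  multiplicity (first_lists U K) t <= multiplicity (first_lists U K') t.
Proof.
elim: K' => [|K' IH]; first by rewrite leqn0 => /eqP ->; lra.
rewrite leq_eqVlt => /orP[/eqP ->|/IH]; first lra.
by rewrite /= multiplicity_cat; have := multiplicity_ge0 (U K') t; lra.
Qed.

Lemma covered_first_lists U k K t : (k < K)%N ->
  covered (U k) t -> covered (first_lists U K) t.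
Proof.
elim: K => // K IH; rewrite ltnS leq_eqVlt /= covered_cat => /orP[/eqP ->|/IH kK].
  by left.
by right; exact: kK.
Qed.

(** Lebesgue negligibility, in terms of covers only; bounding the finite
    partial sums avoids infinite series. *)
Definition thin (E : set R) : Prop := forall e, 0 < e ->
  exists U : nat -> seq (R * R), (forall x, E x -> exists k, covered (U k) x) /\
    forall K, total_length (first_lists U K) <= e.

(** The budgets [e / 2 ^ k.+1] add up to at most [e]. *)
Lemma total_length_geometric U e :
  (forall k, total_length (U k) <= e * (1 / 2) ^ k.+1) ->
  forall K, total_length (first_lists U K) <= e * (1 - (1 / 2) ^ K).
Proof.
move=> Ue; elim=> [|K IH] /=; first lra.
by rewrite total_length_cat; have := Ue K => /=; lra.
Qed.

Lemma thin_geometric (E : set R) :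
  (forall e : R, 0 < e -> exists U : nat -> seq (R * R),
     (forall x, E x -> exists k, covered (U k) x) /\
     forall k, total_length (U k) <= e * (1 / 2) ^ k.+1) -> thin E.
Proof.
move=> EU e e0; have [U [EUx Ue]] := EU e e0; exists U; split => // K.
have p0 : 0 < (1 / 2) ^ K by apply: pow_lt; lra.
have := total_length_geometric _ _ Ue K; nra.
Qed.

Lemma total_length_first_lists_cat U V K :
  total_length (first_lists (fun k => U k ++ V k) K) =
  total_length (first_lists U K) + total_length (first_lists V K).
Proof. by elim: K => [|K IH] /=; rewrite ?total_length_cat ?IH; lra. Qed.

Lemma thinU (E F : set R) : thin E -> thin F -> thin (E `|` F).
Proof.
move=> tE tF e e0; have e2 : 0 < e / 2 by lra.
have [[U [EU Ue]] [V [FV Ve]]] := (tE _ e2, tF _ e2).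
exists (fun k => U k ++ V k); split => [x [/EU|/FV] [k kx]|K].
- by exists k; rewrite covered_cat; left.
- by exists k; rewrite covered_cat; right.
- by rewrite total_length_first_lists_cat; have := Ue K; have := Ve K; lra.
Qed.

Lemma thinS (E F : set R) : E `<=` F -> thin F -> thin E.
Proof.
move=> EF tF e /tF[U [FU Ue]]; exists U; split => // x Ex.
by apply: FU; exact: EF.
Qed.

(** * Lebesgue null sets are thin *)

(** The completed measure of a set, measurable or not, unfolds to its outer
    measure: the infimum of the total lengths of covers by half-open
    intervals. *)
Lemma null_set_half_open_cover (T : realType) (X : set T) (e : T) :
  completed_lebesgue_measure X = 0%E -> (0 < e)%R ->
  exists u v : nat -> T,
    (forall k, (u k <= v k)%R) /\
    (forall x, X x -> exists k, (u k < x <= v k)%R) /\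
    (forall K, (\sum_(k < K) (v k - u k) <= e)%R).
Proof.
move=> X0 e0.
have infE : ereal_inf [set \sum_(k <oo) wlength idfun (A k) | A in
    measurable_cover (X : set (ocitv_type T))]%E = 0%E by exact: X0.
have inf_fin : ereal_inf [set \sum_(k <oo) wlength idfun (A k) | A in
    measurable_cover (X : set (ocitv_type T))]%E \is a fin_num by rewrite infE.
have [_ [A [mA XA] <-]] := lb_ereal_inf_adherent e0 inf_fin.
rewrite infE add0e => Ae.
have /choice[p pP] (k : nat) :
    exists p : T * T, (p.1 <= p.2)%R /\ A k = `]p.1, p.2]%classic.
  case/ocitvP: (mA k) => [->|[x x12 ->]]; last by exists x; rewrite ltW.
  (* The empty members of the cover become degenerate intervals. *)
  by exists (0, 0)%R; rewrite lexx set_itv_ge// bnd_simp ltxx.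
exists (fun k => (p k).1), (fun k => (p k).2); split => [k|]; first by case: (pP k).
split => [x /XA[k _]|K].
  by rewrite (pP k).2 /= in_itv /= => xk; exists k.
rewrite -lee_fin -sumEFin; apply: le_trans (ltW Ae).
have w0 k : (0 <= wlength idfun (A k))%E by exact: wlength_ge0.
apply: le_trans (nneseries_lim_ge K (fun k _ _ => w0 k)).
rewrite big_mkord; apply: lee_sum => k _.
by rewrite (pP k).2 wlength_itv_bnd//; exact: (pP k).1.
Qed.

(** A half-open interval is the open one together with its right end, which
    gets a tiny interval of its own. *)
Lemma thin_of_null (E : set R) :
  completed_lebesgue_measure E = 0%E -> thin E.
Proof.
move=> E0 e e0.
have [|u [v [uv [Euv sumuv]]]] := null_set_half_open_cover _ _ (e / 2) E0.
  by apply/RltP; exact: Rdiv_lt_0_compat e0 Rlt_0_2.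
pose s k := e / 4 * (1 / 2) ^ k.+1.
have s0 k : 0 < s k by rewrite /s; apply: Rmult_lt_0_compat; [lra | apply: pow_lt; lra].
pose U k := [:: (u k, v k)]; pose V k := [:: (v k - s k, v k + s k)].
exists (fun k => U k ++ V k); split => [x /Euv[k /andP[/RltP ux /RleP xv]]|K].
  exists k => /=; have := s0 k.
  by case: xv => [xv|->]; [left | right; left]; lra.
rewrite total_length_first_lists_cat.
have Ve : total_length (first_lists V K) <= e / 2.
  have Vk k : total_length (V k) <= e / 2 * (1 / 2) ^ k.+1.
    have sk := s0 k; rewrite /V /total_length /= Rmax_right; last lra.
    by rewrite /s /=; lra.
  have p0 : 0 < (1 / 2) ^ K by apply: pow_lt; lra.
  have := total_length_geometric _ _ Vk K; nra.
have Ue : total_length (first_lists U K) <= e / 2.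
  apply: Rle_trans (RleP (sumuv K)); apply: Req_le.
  elim: K {Ve} => [|K IH]; first by rewrite big_ord0.
  rewrite big_ord_recr /= IH Rmax_right; first by rewrite addrC.
  by have /RleP := uv K; lra.
lra.
Qed.

(** * Discontinuities of a Riemann integrable function *)

(** The definition speaks of a punctured neighbourhood; at [x] itself the
    inequality is trivial. *)
Lemma continue_inP (f : R -> R) (D : set R) (x : R) :
  continue_in f D x <-> forall e, 0 < e -> exists d, 0 < d /\
    forall y, D y -> Rabs (y - x) < d -> Rabs (f y - f x) < e.
Proof.
split=> fx e e0; have [d [d0 fd]] := fx e e0; exists d; split=> //.
  move=> y Dy yx; have [<-|xy] := Req_dec x y; first by rewrite Rminus_diag Rabs_R0.
  by apply: fd; split.
by move=> y [[Dy _] yx]; exact: fd.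
Qed.

(** The cover consists of the steps where [Rabs f >= sigma], whose total
    length is bounded by Markov's inequality, and of intervals of total length
    at most [tau] around the division points.  That [a] is covered is only
    there for the induction: it tells the next stage that an uncovered point
    is not the division point at which two steps meet. *)
Lemma step_cover (f : R -> R) (b tau sigma : R) (l lf : list R) :
  0 < tau -> 0 < sigma -> forall a, a <= b -> adapted_couple f a b l lf ->
  exists L, total_length L <= tau + Int_SF (List.map Rabs lf) l / sigma /\
    covered L a /\
    forall x, a <= x <= b -> ~ covered L x -> exists d y, 0 < d /\ Rabs y < sigma /\
      forall z, a <= z <= b -> Rabs (z - x) < d -> f z = y.
Proof.
move=> + sigma0; elim: lf l tau => [|y lf IH] l tau tau0 a ab.
  move=> [_ [+ [+ [+ _]]]].
  case: l => [|r [|? ?]] //= ra rb _; exists [:: (a - tau / 2, a + tau / 2)].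
  rewrite Rmin_left // in ra; rewrite Rmax_right // in rb.
  split; first by rewrite /= Rmax_right; lra.
  split; first by left => /=; lra.
  move=> x xab /=; case; left; lra.
case: l => [|r1 [|r2 l]] H; try by move: H => [_ [_ [_ []]]].
have tail := StepFun_P7 ab H.
move: H => [ord [r1a [_ [_ cst]]]].
rewrite /= Rmin_left // in r1a; subst r1.
have ar2 : a <= r2 by apply: (ord 0%nat) => /=; apply: PeanoNat.Nat.lt_0_succ.
have r2b : r2 <= b.
  by move: tail => [_ [/= E _]]; rewrite E; exact: Rmin_r.
have fy := cst 0%nat (PeanoNat.Nat.lt_0_succ _).
rewrite /= in fy.
(* Half of [tau] goes to the division point [a], half to the others. *)
have tau2 : 0 < tau / 2 by lra.
have [L [Ltau [Lr2 Lgood]]] := IH _ _ tau2 _ r2b tail.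
pose B := if Rlt_dec (Rabs y) sigma then [::] else [:: (a, r2)].
exists ((a - tau / 4, a + tau / 4) :: B ++ L); split; last split.
- have BI : total_length B <= Rabs y * (r2 - a) / sigma.
    rewrite /B; case: Rlt_dec => ys.
      rewrite /=; apply: Rmult_le_pos; last by left; exact: Rinv_0_lt_compat.
      by apply: Rmult_le_pos; [exact: Rabs_pos | lra].
    rewrite /= Rmax_right; last lra.
    apply: (Rmult_le_reg_r sigma) => //.
    rewrite Rplus_0_r /Rdiv Rmult_assoc Rinv_l; last lra.
    by nra.
  rewrite [total_length _]/= total_length_cat Rmax_right /=; last lra.
  have -> : (Rabs y * (r2 - a) + Int_SF (List.map Rabs lf) (r2 :: l)) / sigma =
    Rabs y * (r2 - a) / sigma + Int_SF (List.map Rabs lf) (r2 :: l) / sigma by field; lra.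
  by rewrite -/(total_length _); lra.
- by left => /=; lra.
move=> x xab; rewrite /= covered_cat => nx.
have xa : a < x by case: xab => -[//|xa] _; case: nx; left; lra.
case: (Rtotal_order x r2) => [xr2|[xr2|xr2]].
- have ysig : Rabs y < sigma.
    case: (Rlt_dec (Rabs y) sigma) => // ys; case: nx; right; left.
    by rewrite /B; case: Rlt_dec => //= _; left.
  exists (Rmin (x - a) (r2 - x)), y; split; first by apply: Rmin_pos; lra.
  split=> // z _ zx; apply: fy.
  have := Rmin_l (x - a) (r2 - x); have := Rmin_r (x - a) (r2 - x).
  by split; move: zx; split_Rabs; lra.
- by case: nx; right; right; rewrite xr2.
have [||d [v [d0 [vs fv]]]] := Lgood x; first by lra.
  by move=> Lx; apply: nx; right; right.
exists (Rmin d (x - r2)), v; split; first by apply: Rmin_pos; lra.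
split=> // z zab zx; apply: fv.
  by have := Rmin_r d (x - r2); move: zx; split_Rabs; lra.
by have := Rmin_l d (x - r2); lra.
Qed.

Lemma StepFun_cover (a b tau sigma : R) (phi : StepFun a b) :
  a <= b -> 0 < tau -> 0 < sigma ->
  exists L, total_length L <=
      tau + RiemannInt_SF (mkStepFun (StepFun_P32 phi)) / sigma /\
    forall x, a <= x <= b -> ~ covered L x -> exists d y, 0 < d /\ Rabs y < sigma /\
      forall z, a <= z <= b -> Rabs (z - x) < d -> phi z = y.
Proof.
move=> ab tau0 sigma0.
have [L [Ltau [_ Lgood]]] :=
  step_cover phi b tau sigma _ _ tau0 sigma0 a ab (StepFun_P1 phi).
exists L; split=> //; rewrite /RiemannInt_SF; case: Rle_dec => // _.
rewrite (StepFun_P17 (StepFun_P1 (mkStepFun (StepFun_P32 phi)))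
  (StepFun_P31 (StepFun_P1 phi))).
exact: Ltau.
Qed.

(** Where [phi] is locally constant and [psi < sigma / 2], the inequality
    [|f - phi| <= psi] keeps [f] within [sigma] of its value at [x]. *)
Lemma RInt_oscillation_cover (f : R -> R) (a b sigma eta : R) :
  a <= b -> ex_RInt f a b -> 0 < sigma -> 0 < eta ->
  exists L, total_length L <= eta /\
    forall x, a <= x <= b -> ~ covered L x -> exists d, 0 < d /\
      forall z, a <= z <= b -> Rabs (z - x) < d -> Rabs (f z - f x) < sigma.
Proof.
move=> ab fint sigma0 eta0.
have eps0 : 0 < eta * sigma / 8 by have := Rmult_lt_0_compat _ _ eta0 sigma0; lra.
have [phi [psi []]] := ex_RInt_Reals_0 f a b fint (mkposreal _ eps0).
rewrite (Rmin_left _ _ ab) (Rmax_right _ _ ab) /= => fphi /Rabs_def2[psiI _].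
have eta4 : 0 < eta / 4 by lra.
have sigma2 : 0 < sigma / 2 by lra.
have [Lpsi [Lpsi_len Lpsi_good]] := StepFun_cover _ _ _ _ psi ab eta4 sigma2.
pose I := RiemannInt_SF (mkStepFun (StepFun_P32 phi)).
have I0 : 0 <= I by apply: Rle_trans (Rabs_pos _) (StepFun_P34 phi ab).
(* Any threshold large enough to make the last term at most [eta / 4] does:
   for [phi] only local constancy is wanted. *)
have T0 : 0 < (1 + I) / (eta / 4) by apply: Rdiv_lt_0_compat; lra.
have [Lphi [Lphi_len Lphi_good]] := StepFun_cover _ _ _ _ phi ab eta4 T0.
exists (Lphi ++ Lpsi); split.
  rewrite total_length_cat.
  have : RiemannInt_SF (mkStepFun (StepFun_P32 psi)) <= RiemannInt_SF psi.
    apply: StepFun_P37 => //= x xab; have := fphi x.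
    have := Rabs_pos (f x - phi x) => fx /(_ ltac:(lra)) fxpsi.
    by rewrite Rabs_pos_eq; lra.
  move=> psiabs.
  have : RiemannInt_SF (mkStepFun (StepFun_P32 psi)) / (sigma / 2) <= eta / 4.
    apply: (Rmult_le_reg_r (sigma / 2)) => //.
    by rewrite /Rdiv Rmult_assoc Rinv_l; lra.
  have : I / ((1 + I) / (eta / 4)) <= eta / 4.
    have -> : I / ((1 + I) / (eta / 4)) = eta / 4 * (I / (1 + I)) by field; lra.
    have : I / (1 + I) <= 1.
      by apply: (Rmult_le_reg_r (1 + I)); rewrite ?/Rdiv ?Rmult_assoc ?Rinv_l; lra.
    by nra.
  by rewrite -/I in Lphi_len; lra.
move=> x xab; rewrite covered_cat => nx.
have [|d1 [y1 [d10 [_ phi1]]]] := Lphi_good x xab; first by tauto.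
have [|d2 [y2 [d20 [y2s psi2]]]] := Lpsi_good x xab; first by tauto.
exists (Rmin d1 d2); split; first exact: Rmin_pos.
have xx d : 0 < d -> Rabs (x - x) < d by rewrite Rminus_diag Rabs_R0.
move=> z zab zx; have := Rmin_l d1 d2; have := Rmin_r d1 d2 => m2 m1.
have := fphi z zab; have := fphi x xab.
rewrite (phi1 z) ?(phi1 x) ?(psi2 z) ?(psi2 x) //; try lra; try exact: xx.
by move: y2s; split_Rabs; lra.
Qed.

(** A point missed by the covers for all the oscillations [1/(k+1)] is a point
    of continuity. *)
Lemma thin_discontinuities (f : R -> R) (a b : R) :
  a <= b -> ex_RInt f a b -> thin (discontinuities a b f).
Proof.
move=> ab fint; apply: thin_geometric => e e0.
have sig0 k : 0 < / INR k.+1 by apply/Rinv_0_lt_compat/lt_0_INR/PeanoNat.Nat.lt_0_succ.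
have eta0 k : 0 < e * (1 / 2) ^ k.+1.
  by apply: Rmult_lt_0_compat => //; apply: pow_lt; lra.
have /choice[U UP] k := RInt_oscillation_cover f a b _ _ ab fint (sig0 k) (eta0 k).
exists U; split=> [x [xab disc]|k]; last exact: (UP k).1.
apply: contrapT => nx; apply: disc; apply/continue_inP => s s0.
have [k [ks kpos]] := archimed_cor1 s s0.
case: k ks kpos => [|k] ks kpos; first by move: kpos => /PeanoNat.Nat.lt_irrefl.
have [|d [d0 fd]] := (UP k).2 x xab; first by move=> kx; apply: nx; exists k.
by exists d; split=> // y yab yx; apply: Rlt_trans ks; exact: fd.
Qed.

(** * Bounded functions with thin discontinuities *)

Lemma covered_open L t : covered L t ->
  exists d, 0 < d /\ forall x, Rabs (x - t) < d -> covered L x.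
Proof.
elim: L => //= J L IH [Jt|/IH[d [d0 dL]]]; last first.
  by exists d; split=> // x /dL; right.
exists (Rmin (t - J.1) (J.2 - t)); split; first by apply: Rmin_pos; lra.
move=> x; have := Rmin_l (t - J.1) (J.2 - t); have := Rmin_r (t - J.1) (J.2 - t).
by left; split_Rabs; lra.
Qed.

(** A Lebesgue number argument: near each point one of the alternatives holds
    (the second at points of continuity), and compactness of [[a, b]] makes
    the radius uniform. *)
Lemma uniform_dichotomy (h : R -> R) (a b eps : R) (U : nat -> seq (R * R)) :
  0 < eps ->
  (forall x, discontinuities a b h x -> exists k, covered (U k) x) ->
  exists d, 0 < d /\ forall x, a <= x <= b ->
    (exists k, forall z, Rabs (z - x) < d -> covered (U k) z) \/
    (forall z, a <= z <= b -> Rabs (z - x) < d -> Rabs (h z - h x) <= eps).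
Proof.
move=> eps0 Udisc.
(* The factor [2] leaves room to recentre from [t] to a point [x] near it. *)
have gauge t : exists d : posreal, a <= t <= b ->
    (exists k, forall z, Rabs (z - t) < 2 * d -> covered (U k) z) \/
    (forall z, a <= z <= b -> Rabs (z - t) < 2 * d -> Rabs (h z - h t) < eps / 2).
  have [tab|] := EM (a <= t <= b); last by exists (mkposreal 1 Rlt_0_1).
  have half d : 0 < d -> 0 < d / 2 by lra.
  have dbl d : 2 * (d / 2) = d by field.
  have [ht|/(conj tab)/Udisc[k /covered_open[d [d0 dU]]]] :=
    EM (continue_in h (cc a b) t).
    have /continue_inP/(_ _ (half _ eps0))[d [d0 hd]] := ht.
    by exists (mkposreal _ (half _ d0)) => _; right; rewrite /= dbl.
  by exists (mkposreal _ (half _ d0)) => _; left; exists k; rewrite /= dbl.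
have [delta deltaP] := choice gauge.
have [d dP] := compactness_value_1d a b delta.
exists d; split; first exact: cond_pos.
move=> x xab; have [t [tab [xt dt]]] := contrapT (dP x xab).
have near z : Rabs (z - x) < d -> Rabs (z - t) < 2 * delta t.
  by move: xt dt; split_Rabs; lra.
have nearx : Rabs (x - t) < 2 * delta t by have := cond_pos (delta t); lra.
have [[k kU]|ht] := deltaP t tab; [left | right].
  by exists k => z /near /kU.
move=> z zab /near zt; have := ht z zab zt; have := ht x xab nearx.
by split_Rabs; lra.
Qed.

(** Induction on the number of pieces of length [d / 2] in [[a, x]]: on the
    last piece, [h] is replaced by the constant [h x].  Only finitely many lists
    [U k] are called upon, and the larger of two ranks serves for both. *)
Lemma approx_on_initial_segment (h : R -> R) (a b eps M d : R)
    (U : nat -> seq (R * R)) :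
  0 < eps -> 0 < d ->
  (forall x, a <= x <= b -> Rabs (h x) <= M) ->
  (forall x, a <= x <= b ->
    (exists k, forall z, Rabs (z - x) < d -> covered (U k) z) \/
    (forall z, a <= z <= b -> Rabs (z - x) < d -> Rabs (h z - h x) <= eps)) ->
  forall (n : nat) x, a <= x <= b -> x <= a + INR n * (d / 2) ->
  exists (K : nat) (phi : R -> R), ex_RInt phi a x /\
    forall t, a <= t <= x ->
      Rabs (h t - phi t) <= eps + 2 * M * multiplicity (first_lists U K) t.
Proof.
move=> eps0 d0 hM dich.
have M0 x : a <= x <= b -> 0 <= M by move=> /hM; have := Rabs_pos (h x); lra.
elim=> [|n IH] x xab xn.
  have xa : x = a by move: xn => /=; lra.
  exists 0%N, (fun=> h a); split=> [|t tx]; first exact: ex_RInt_const.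
  have -> : t = a by lra.
  by rewrite Rminus_diag Rabs_R0 /=; lra.
pose y := Rmax a (x - d / 2).
have [ay xy] : a <= y /\ x - d / 2 <= y by split; [exact: Rmax_l | exact: Rmax_r].
have yx : y <= x by apply: Rmax_lub; lra.
have yn : y <= a + INR n * (d / 2).
  rewrite S_INR in xn; have := pos_INR n => n0.
  by apply: Rmax_lub; nra.
have [|K [phi [phiint phih]]] := IH y _ yn; first by lra.
pose phi' t := if Rle_dec t y then phi t else h x.
have phi'int : ex_RInt phi' a x.
  apply: (ex_RInt_Chasles _ _ y).
    apply: ex_RInt_ext phiint => t.
    by rewrite Rmin_left // Rmax_right // /phi' => ty; case: Rle_dec => //= ?; lra.
  apply: (ex_RInt_ext (fun=> h x)); last exact: ex_RInt_const.
  move=> t; rewrite Rmin_left // Rmax_right // /phi' => ty.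
  by case: Rle_dec => //= ?; lra.
have [K' [KK' last_piece]] : exists K', (K <= K')%N /\ forall t, y < t <= x ->
    Rabs (h t - h x) <= eps + 2 * M * multiplicity (first_lists U K') t.
  have [[k kU]|hx] := dich x xab.
    exists (maxn K k.+1); split=> [|t tx]; first exact: leq_maxl.
    have tU : covered (first_lists U (maxn K k.+1)) t.
      apply: (@covered_first_lists _ k); first exact: leq_maxr.
      by apply: kU; split_Rabs; lra.
    have := covered_multiplicity _ _ tU; have := M0 x xab.
    have := hM x xab; have := hM t ltac:(lra) => ht hx Mx mt.
    by have : Rabs (h t - h x) <= 2 * M by [split_Rabs; lra]; nra.
  exists K; split=> // t tx; have := multiplicity_ge0 (first_lists U K) t.
  have : Rabs (h t - h x) <= eps by apply: hx; [lra | split_Rabs; lra].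
  by have := M0 x xab; nra.
exists K', phi'; split=> // t tx; rewrite /phi'; case: Rle_dec => /= ty.
  have ht := phih t ltac:(lra).
  have mono := multiplicity_first_lists_mono U K K' t KK'.
  by have := M0 x xab; nra.
by apply: last_piece; lra.
Qed.

(** Half of the tolerance [e] is spent on the small oscillations, over length
    [b - a], and half on the cover, where [h] varies by at most [2 * M]. *)
Lemma ex_RInt_of_thin_discontinuities (h : R -> R) (a b : R) :
  a < b -> bounded_on (cc a b) h -> thin (discontinuities a b h) -> ex_RInt h a b.
Proof.
move=> ab [M0 hM0] thinh; have ab' : a <= b by lra.
(* Adding [1] makes the bound positive, so that one can divide by it. *)
pose M := Rabs M0 + 1; have Mpos : 0 < M by rewrite /M; have := Rabs_pos M0; lra.
have hM x : a <= x <= b -> Rabs (h x) <= M.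
  by move=> /hM0; rewrite /M; have := Rle_abs M0; lra.
apply: ex_RInt_of_close_integrable => // e e0.
pose eps := e / (2 * (b - a)).
have eps0 : 0 < eps by apply: Rdiv_lt_0_compat; lra.
have eta0 : 0 < e / (4 * M) by apply: Rdiv_lt_0_compat; lra.
have [U [Udisc Ulen]] := thinh _ eta0.
have [d [d0 dich]] := uniform_dichotomy h a b eps U eps0 Udisc.
have [n nb] := INR_unbounded ((b - a) / (d / 2)).
have bn : b <= a + INR n * (d / 2).
  have : (b - a) / (d / 2) * (d / 2) < INR n * (d / 2) by apply: Rmult_lt_compat_r; lra.
  have -> : (b - a) / (d / 2) * (d / 2) = b - a by field; lra.
  by lra.
have bab : a <= b <= b by lra.
have [K [phi [phiint phih]]] :=
  approx_on_initial_segment h a b eps M d U eps0 d0 hM dich n b bab bn.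
have [l [mint lK]] := is_RInt_multiplicity (first_lists U K) a b ab'.
exists phi, (fun t => eps + 2 * M * multiplicity (first_lists U K) t),
  ((b - a) * eps + 2 * M * l); split=> //; split; last split=> //.
  apply: (is_RInt_plus (fun=> eps)); first exact: is_RInt_const.
  exact: (is_RInt_scal _ _ _ (2 * M)).
have -> : (b - a) * eps = e / 2 by rewrite /eps; field; lra.
have : 2 * M * l <= 2 * M * (e / (4 * M)).
  by apply: Rmult_le_compat_l; [lra | have := Ulen K; lra].
have -> : 2 * M * (e / (4 * M)) = e / 2 by field; lra.
lra.
Qed.

(** * Composition *)

Lemma discontinuities_comp (a b c d : R) (f G : R -> R) :
  (forall x, cc a b x -> cc c d (f x)) ->
  discontinuities a b (fun x => G (f x)) `<=`
    discontinuities a b f `|` preimage_cc a b f (discontinuities c d G).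
Proof.
move=> fcd x [xab disc].
have [fx|fx] := EM (continue_in f (cc a b) x); last by left.
right; split=> //; split; first exact: fcd.
move=> /continue_inP Gfx; apply: disc; apply/continue_inP => e e0.
have [s [s0 Gs]] := Gfx e e0.
have /continue_inP/(_ _ s0)[r [r0 fr]] := fx.
by exists r; split=> // y yab yx; apply: Gs; [exact: fcd | exact: fr].
Qed.

Theorem theorem2p2 (a b c d : R) (f G : R -> R)
  (hab : a < b) (hcd : c < d)
  (hf_maps : forall x : R, cc a b x -> cc c d (f x))
  (hf_int : ex_RInt f a b)
  (hG_bounded : bounded_on (cc c d) G)
  (hnull : completed_lebesgue_measure
             (preimage_cc a b f (discontinuities c d G)) = 0%E) :
  ex_RInt (fun x : R => G (f x)) a b.
Proof.
apply: ex_RInt_of_thin_discontinuities => //.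
  by have [M GM] := hG_bounded; exists M => x /hf_maps/GM.
apply: thinS (discontinuities_comp a b c d f G hf_maps) _.
apply: thinU; last exact: thin_of_null.
by apply: thin_discontinuities => //; lra.
Qed.
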